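(* Let $K$ be a complete non-Archimedean field and let $f(x)=x_0+\lambda(x-x_0)+O((x-x_0)^2)\in K[[x-x_0]]$, where $|\lambda|=1$ and $\lambda$ is not a root of unity. Suppose $f$ is analytically conjugate to $T_\lambda:x\mapsto\lambda x$ on the linearization disc $\Delta_f(x_0)$ in $K$, via a conjugacy function $g$ with $g(x_0)=0$ and $|g'(x_0)|=1$. Suppose that the subset $X\subseteq\Delta_f(x_0)$ satisfies $f(X)\subseteq X$. Then: 1) $f$ is transitive on $X$ if and only if $T_\lambda$ is transitive on $g(X)$; 2) if $X$ is compact and $f$ is transitive on $X$, then $f$ is minimal on $X$; moreover $f(X)=X$ and $g(X)=T_\lambda(g(X))$.
   Context: $K$ is complete with respect to a nontrivial absolute value satisfying $|x+y|\le\max(|x|,|y|)$. The conjugacy function $g$ is a power series in $x-x_0$; the linearization disc $\Delta_f(x_0)$ is the largest disc $U\subseteq K$ containing $x_0$ such that $g$ converges and is one-to-one on $U$ and $g(f(x))=\lambda g(x)$ for all $x\in U$. A map $h:Y\to Y$ is transitive if some $y\in Y$ has forward orbit $\{h^{\circ n}(y)\}_{n\ge0}$ dense in $Y$, and minimal if every forward orbit is dense in $Y$. *)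

(* Defs.v *)
From HB Require Import structures.
From mathcomp Require Import all_boot all_order all_algebra.
From mathcomp Require Import reals.
From Stdlib Require Import ClassicalEpsilon.
Set Implicit Arguments. Unset Strict Implicit. Unset Printing Implicit Defensive.
Import Order.TTheory GRing.Theory Num.Theory.
Local Open Scope ring_scope.

Section Defs.
Variables (R : realType) (K : fieldType) (abs : K -> R).

Definition nonarch_abs : Prop :=
  [/\ (forall x, 0 <= abs x),
      (forall x, abs x = 0 <-> x = 0),
      (forall x y, abs (x * y) = abs x * abs y),
      (forall x y, abs (x + y) <= Num.max (abs x) (abs y)) &
      (exists x, abs x != 0 /\ abs x != 1)].

Definition conv_to (u : nat -> K) (l : K) : Prop :=
  forall e : R, 0 < e -> exists N, forall n, (N <= n)%N -> abs (u n - l) < e.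

Definition cauchy (u : nat -> K) : Prop :=
  forall e : R, 0 < e -> exists N, forall m n, (N <= m)%N -> (N <= n)%N ->
    abs (u m - u n) < e.

Definition complete_abs : Prop :=
  forall u, cauchy u -> exists l, conv_to u l.

Definition psum (a : nat -> K) (c x : K) (n : nat) : K :=
  \sum_(i < n) a i * (x - c) ^+ i.

Definition ps_conv (a : nat -> K) (c x : K) : Prop :=
  exists l, conv_to (psum a c x) l.

(* the value of the power series at x (meaningful when it converges) *)
Definition ps_eval (a : nat -> K) (c x : K) : K :=
  epsilon (inhabits 0) (fun l => conv_to (psum a c x) l).

(* discs centred at c (in an ultrametric field every point of a disc is a
   centre), including the degenerate "disc" K itself *)
Definition is_disc (c : K) (U : K -> Prop) : Prop :=
  (forall x, U x) \/
  exists r : R, 0 < r /\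
    ((forall x, U x <-> abs (x - c) < r) \/ (forall x, U x <-> abs (x - c) <= r)).

Definition lin_props (fa ga : nat -> K) (lam x0 : K) (U : K -> Prop) : Prop :=
  [/\ (forall x, U x -> ps_conv ga x0 x),
      (forall x y, U x -> U y -> ps_eval ga x0 x = ps_eval ga x0 y -> x = y) &
      (forall x, U x -> ps_conv fa x0 x /\ ps_conv ga x0 (ps_eval fa x0 x) /\
         ps_eval ga x0 (ps_eval fa x0 x) = lam * ps_eval ga x0 x)].

Definition lin_disc (fa ga : nat -> K) (lam x0 : K) (D : K -> Prop) : Prop :=
  [/\ is_disc x0 D, D x0, lin_props fa ga lam x0 D &
      (forall U, is_disc x0 U -> U x0 -> lin_props fa ga lam x0 U ->
         forall x, U x -> D x)].

Definition img (h : K -> K) (X : K -> Prop) : K -> Prop :=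
  fun y => exists x, X x /\ h x = y.

Definition dense_in (S Y : K -> Prop) : Prop :=
  forall z, Y z -> forall e : R, 0 < e -> exists y, S y /\ abs (y - z) < e.

Definition orbit (h : K -> K) (y : K) : K -> Prop :=
  fun z => exists n, iter n h y = z.

Definition transitive_on (h : K -> K) (Y : K -> Prop) : Prop :=
  exists y, Y y /\ dense_in (orbit h y) Y.

Definition minimal_on (h : K -> K) (Y : K -> Prop) : Prop :=
  forall y, Y y -> dense_in (orbit h y) Y.

Definition open_set (O : K -> Prop) : Prop :=
  forall x, O x -> exists e : R, 0 < e /\ forall y, abs (y - x) < e -> O y.

Definition compact_set (X : K -> Prop) : Prop :=
  forall (I : Type) (O : I -> K -> Prop), (forall i, open_set (O i)) ->
    (forall x, X x -> exists i, O i x) ->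
    exists (n : nat) (s : 'I_n -> I), forall x, X x -> exists k : 'I_n, O (s k) x.
End Defs.

(* Main.v *)
Require Import Defs.
From HB Require Import structures.
From mathcomp Require Import all_boot all_order all_algebra.
From mathcomp Require Import reals.
From mathcomp Require Import zify ring lra.
From Stdlib Require Import Classical ClassicalEpsilon.
Import Order.TTheory GRing.Theory Num.Theory.
Local Open Scope ring_scope.
Set Implicit Arguments. Unset Strict Implicit. Unset Printing Implicit Defensive.

(** The map [g] conjugates [f] to the isometry [T : w |-> lam w], so everything
    follows once [g] is a homeomorphism from [X] onto [g(X)] in a sense strong
    enough for orbits.  Two facts supply this.

    - [|f(x) - x0| <= |x - x0|] on [D], so an orbit stays in a closed disc
      contained in [D].  Writing [|.|_rho] for Gauss norms, [g o f = lam g] as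
      formal power series gives [|g|_sigma = |g|_rho] for [sigma = |f|_rho],
      and [|g|] is strictly increasing in the radius, so [sigma = rho].
    - On a closed disc inside [D] the inverse of [g] is continuous.  If [d] is
      the largest index at which the Gauss norm of [g] is attained, a divided
      difference estimate shows that [g] cannot be within [|g_d| eta^d] of the
      same value at [d + 1] points that are [eta]-separated.  Hence
      points [x_n] with [g(x_n) -> g(z)] accumulate, by completeness, at some
      [l] with [g(l) = g(z)], and [l = z] by injectivity.

    On a compact [X], pigeonhole makes the dense orbit of [T] on [g(X)]
    recurrent, and an isometry with a dense recurrent orbit is minimal. *)

(** * Powers, roots and largest terms of real sequences *)

Section RealSequences.
Variable R : realType.

Lemma expr_unbounded (t C : R) : 1 < t -> exists k : nat, C <= t ^+ k.
Proof.
move=> t1.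
have bern k : 1 + (t - 1) * k%:R <= t ^+ k.
  elim: k => [|k IH]; first by rewrite expr0 mulr0 addr0.
  rewrite exprS; have k0 : 0 <= k%:R :> R by [].
  have : t * (1 + (t - 1) * k%:R) <= t * t ^+ k by rewrite ler_pM2l //; lra.
  have : 0 <= (t - 1) ^+ 2 * k%:R by rewrite mulr_ge0 ?sqr_ge0.
  rewrite -natr1; lra.
exists (Num.bound ((Num.max 0 C) / (t - 1))); apply: le_trans (bern _).
have q0 : 0 <= Num.max 0 C / (t - 1) by rewrite divr_ge0 ?le_max ?lexx //; lra.
have /ltW := archi_boundP q0; rewrite ler_pdivrMr; last lra.
have : C <= Num.max 0 C by rewrite le_max lexx orbT.
lra.
Qed.

(** [Num.sqrt q] pays for one factor of [t], and induction at [Num.sqrt q] for the other [n]. This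
    supplies the fine grid of radii in [conj_coef_bound]. *)
Lemma small_root (n : nat) (q : R) : 1 < q -> exists2 t : R, 1 < t & t ^+ n <= q.
Proof.
elim: n q => [|n IH] q q1; first by exists q => //; rewrite expr0 ltW.
have s1 : 1 < Num.sqrt q by rewrite -sqrtr1 ltr_sqrt //; lra.
have [t t1 tn] := IH _ s1.
exists (Num.min t (Num.sqrt q)); first by rewrite lt_min t1.
have m0 : 0 <= Num.min t (Num.sqrt q) by rewrite le_min sqrtr_ge0 andbT; lra.
rewrite exprS -[leRHS]sqr_sqrtr ?expr2; last lra.
apply: ler_pM => //; [exact: exprn_ge0|by rewrite ge_min lexx orbT|].
apply: le_trans tn; apply: lerXn2r; rewrite ?nnegrE // ?ge_min ?lexx //; lra.
Qed.

Lemma half_gt0 (e : R) : 0 < e -> 0 < e / 2. Proof. by move=> ?; lra. Qed.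
Lemma half_lt (e : R) : 0 < e -> e / 2 < e. Proof. by move=> ?; lra. Qed.

(** Past some index all terms lie below [b i0], so only finitely many compete for the maximum; ties
    go to the larger index. *)
Lemma top_dominant (b : nat -> R) (i0 : nat) :
  (forall e, 0 < e -> exists N, forall i, (N <= i)%N -> b i < e) -> 0 < b i0 ->
  exists d, (forall i, b i <= b d) /\ (forall i, (d < i)%N -> b i < b d).
Proof.
move=> b0 bi0.
have fin n : exists2 d, (d <= n)%N & forall i, (i <= n)%N ->
    b i <= b d /\ ((d < i)%N -> b i < b d).
  elim: n => [|n [d dn IH]].
    by exists 0%N => // i; rewrite leqn0 => /eqP ->; split.
  have [bd|bd] := leP (b d) (b n.+1).
    exists n.+1 => // i; rewrite leq_eqVlt => /orP[/eqP ->|].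
      by split=> //; rewrite ltnn.
    rewrite ltnS => ile; have [bi _] := IH _ ile.
    by split; [exact: le_trans bi bd|move=> /ltnW; rewrite leqNgt ltnS ile].
  exists d; first exact: leqW.
  move=> i; rewrite leq_eqVlt => /orP[/eqP ->|]; first by split=> [|_] //; exact: ltW.
  by rewrite ltnS => /IH.
have [N bN] := b0 _ bi0; have [d _ bd] := fin N.
have iN : (i0 <= N)%N by rewrite leqNgt; apply/negP => /ltnW /bN; rewrite ltxx.
have far i : (N < i)%N -> b i < b d.
  by move=> Ni; apply: lt_le_trans (bN _ (ltnW Ni)) _; case: (bd _ iN).
exists d; split=> i => [|di].
  by have [/bd[]|/far/ltW] := leqP i N.
by have [/bd[_]|/far] := leqP i N => //; apply.
Qed.

End RealSequences.

(** * Ultrametric absolute values and limits *)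

Section AbsoluteValue.
Variables (R : realType) (K : fieldType) (abs : K -> R).
Hypothesis habs : nonarch_abs abs.

Lemma abs_ge0 x : 0 <= abs x. Proof. by case: habs. Qed.
Lemma abs_eq0 x : (abs x == 0) = (x == 0).
Proof. by case: habs => _ h _ _ _; apply/eqP/eqP => /h. Qed.
Lemma abs0 : abs 0 = 0. Proof. by apply/eqP; rewrite abs_eq0. Qed.
Lemma abs_gt0 x : (0 < abs x) = (x != 0).
Proof. by rewrite lt0r abs_ge0 andbT abs_eq0. Qed.
Lemma absM x y : abs (x * y) = abs x * abs y. Proof. by case: habs. Qed.
Lemma abs1 : abs 1 = 1.
Proof.
have := absM 1 1; rewrite mulr1 => h.
have n0 : abs 1 != 0 by rewrite abs_eq0 oner_eq0.
by apply: (mulfI n0); rewrite mulr1.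
Qed.
Lemma absN x : abs (- x) = abs x.
Proof.
rewrite -mulN1r absM; suff -> : abs (-1) = 1 by rewrite mul1r.
apply/eqP; rewrite -(@eqrXn2 _ 2) ?abs_ge0 // expr2 -absM mulrNN mulr1 abs1.
by rewrite expr1n.
Qed.
Lemma absX x n : abs (x ^+ n) = abs x ^+ n.
Proof. by elim: n => [|n IH]; rewrite ?abs1 // !exprS absM IH. Qed.
Lemma absB x y : abs (x - y) = abs (y - x).
Proof. by rewrite -absN opprB. Qed.
Lemma absV x : abs x^-1 = (abs x)^-1.
Proof.
have [->|x0] := eqVneq x 0; first by rewrite invr0 abs0 invr0.
have ax0 : abs x != 0 by rewrite abs_eq0.
by apply: (mulfI ax0); rewrite -absM !mulfV // abs1.
Qed.

Lemma absD_le x y A : abs x <= A -> abs y <= A -> abs (x + y) <= A.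
Proof.
by move=> xA yA; case: habs => _ _ _ /(_ x y) h _; apply: le_trans h _; rewrite ge_max xA.
Qed.
Lemma absD_lt x y A : abs x < A -> abs y < A -> abs (x + y) < A.
Proof.
by move=> xA yA; case: habs => _ _ _ /(_ x y) h _; apply: le_lt_trans h _; rewrite gt_max xA.
Qed.
Lemma absB_lt x y A : abs x < A -> abs y < A -> abs (x - y) < A.
Proof. by move=> xA yA; apply: absD_lt; rewrite ?absN. Qed.
Lemma absB_le x y A : abs x <= A -> abs y <= A -> abs (x - y) <= A.
Proof. by move=> xA yA; apply: absD_le; rewrite ?absN. Qed.
Lemma abs_triangle_lt z x y A : abs (x - z) < A -> abs (z - y) < A -> abs (x - y) < A.
Proof. by rewrite -[x - y](subrKA z); exact: absD_lt. Qed.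
Lemma abs_triangle_le z x y A : abs (x - z) <= A -> abs (z - y) <= A -> abs (x - y) <= A.
Proof. by rewrite -[x - y](subrKA z); exact: absD_le. Qed.

Lemma absD_dom x y : abs y < abs x -> abs (x + y) = abs x.
Proof.
move=> yx; apply/le_anti; rewrite absD_le ?(ltW yx) //= leNgt; apply/negP => h.
have : abs (x + y - y) < abs x by apply: absB_lt.
by rewrite addrK ltxx.
Qed.

Lemma abs_sum_le (I : Type) (r : seq I) (P : pred I) (F : I -> K) (A : R) :
  0 <= A -> (forall i, P i -> abs (F i) <= A) -> abs (\sum_(i <- r | P i) F i) <= A.
Proof.
by move=> A0 h; apply: (big_ind (fun z => abs z <= A)) => //; rewrite ?abs0 // => x y; exact: absD_le.
Qed.
Lemma abs_sum_lt (I : Type) (r : seq I) (P : pred I) (F : I -> K) (A : R) :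
  0 < A -> (forall i, P i -> abs (F i) < A) -> abs (\sum_(i <- r | P i) F i) < A.
Proof.
by move=> A0 h; apply: (big_ind (fun z => abs z < A)) => //; rewrite ?abs0 // => x y; exact: absD_lt.
Qed.
Lemma abs_sum_dom (I : finType) (j : I) (F : I -> K) :
  0 < abs (F j) -> (forall i, i != j -> abs (F i) < abs (F j)) ->
  abs (\sum_i F i) = abs (F j).
Proof. by move=> Fj h; rewrite (bigD1 j) //= absD_dom //; exact: abs_sum_lt. Qed.

(** Nontriviality gives an element of absolute value above 1, after inversion if need be; its high
    inverse powers are small. *)
Lemma abs_small_exists (e : R) : 0 < e -> exists2 h, h != 0 & abs h < e.
Proof.
move=> e0; case: habs => _ _ _ _ [x [x0 x1]].
have [y y0 yg] : exists2 y, abs y != 0 & 1 < abs y.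
  have [h|h|h] := ltgtP (abs x) 1; last by rewrite h eqxx in x1.
    exists x^-1; first by rewrite absV invr_eq0.
    by rewrite absV invf_gt1 // lt0r x0 abs_ge0.
  by exists x.
have [k hk] := expr_unbounded (e^-1 + 1) yg.
exists (y ^- k); first by rewrite invr_eq0 expf_neq0 // -abs_eq0.
rewrite absV absX -[ltRHS]invrK ltf_pV2 ?posrE ?invr_gt0 ?exprn_gt0 //; last lra.
lra.
Qed.

Lemma eq_from_abs_lt x y : (forall e, 0 < e -> abs (x - y) < e) -> x = y.
Proof.
move=> h; apply/eqP; rewrite -subr_eq0 -abs_eq0; apply/negPn/negP => n0.
by have := h (abs (x - y)); rewrite ltxx lt0r n0 abs_ge0 => /(_ isT).
Qed.

Lemma conv_abs_le (u : nat -> K) (l v : K) (C : R) (N : nat) :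
  conv_to abs u l -> (forall n, (N <= n)%N -> abs (u n - v) <= C) -> abs (l - v) <= C.
Proof.
move=> ul uv; rewrite leNgt; apply/negP => Cl.
have C0 : 0 <= C by apply: le_trans (abs_ge0 _) (uv _ (leqnn N)).
have [M hM] := ul _ (le_lt_trans C0 Cl).
have : abs (l - v) < abs (l - v).
  apply: (@abs_triangle_lt (u (maxn N M))).
    by rewrite absB; apply: hM; exact: leq_maxr.
  by apply: le_lt_trans Cl; apply: uv; exact: leq_maxl.
by rewrite ltxx.
Qed.

Lemma conv_to_sub (u v : nat -> K) (l m : K) :
  conv_to abs u l -> conv_to abs v m -> conv_to abs (fun n => u n - v n) (l - m).
Proof.
move=> ul vm e e0; have [N hN] := ul _ e0; have [M hM] := vm _ e0.
exists (maxn N M) => n; rewrite geq_max => /andP[nN nM].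
have -> : u n - v n - (l - m) = (u n - l) - (v n - m) by ring.
by apply: absB_lt; [exact: hN|exact: hM].
Qed.

(** * Power series, truncations and tail estimates *)

Definition trunc (a : nat -> K) (n : nat) : {poly K} := \poly_(i < n) a i.

Lemma psumE (a : nat -> K) (c x : K) n : psum a c x n = (trunc a n).[x - c].
Proof. by rewrite /psum /trunc horner_poly. Qed.

Lemma ps_evalP (a : nat -> K) (c x : K) :
  ps_conv abs a c x -> conv_to abs (psum a c x) (ps_eval abs a c x).
Proof. exact: epsilon_spec. Qed.

Lemma ps_conv_terms (a : nat -> K) (c x : K) : ps_conv abs a c x ->
  forall e, 0 < e -> exists N, forall i, (N <= i)%N -> abs (a i) * abs (x - c) ^+ i < e.
Proof.
move=> [l al] e e0; have [N hN] := al _ e0; exists N => i Ni.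
have -> : abs (a i) * abs (x - c) ^+ i = abs (psum a c x i.+1 - psum a c x i).
  by rewrite /psum big_ord_recr [in RHS]addrAC subrr add0r absM absX.
by apply: (@abs_triangle_lt l); [apply: hN; exact: leqW|rewrite absB; exact: hN].
Qed.

Lemma ps_conv_bounded (a : nat -> K) (c x : K) : ps_conv abs a c x ->
  exists2 C, 0 < C & forall i, abs (a i) * abs (x - c) ^+ i <= C.
Proof.
move=> h; have [N hN] := ps_conv_terms h ltr01.
have b0 i : 0 <= abs (a i) * abs (x - c) ^+ i by rewrite mulr_ge0 ?exprn_ge0 ?abs_ge0.
have S0 (P : pred 'I_N) : 0 <= \sum_(i < N | P i) abs (a i) * abs (x - c) ^+ i.
  by apply: sumr_ge0 => i _.
exists (1 + \sum_(i < N) abs (a i) * abs (x - c) ^+ i); first by have := S0 predT; lra.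
move=> i; have [/hN Ni|iN] := leqP N i; first by have := S0 predT; lra.
by rewrite (bigD1 (Ordinal iN)) //=; have := S0 (fun j => j != Ordinal iN); lra.
Qed.

Lemma terms_le (a : R) (r s : R) (i : nat) : 0 <= a -> 0 <= r -> r <= s ->
  a * r ^+ i <= a * s ^+ i.
Proof.
move=> a0 r0 rs; apply: ler_wpM2l => //; apply: lerXn2r => //; rewrite nnegrE //.
exact: le_trans rs.
Qed.

Lemma ps_tail (a : nat -> K) (c x : K) (n : nat) (B : R) : ps_conv abs a c x ->
  0 <= B -> (forall i, (n <= i)%N -> abs (a i) * abs (x - c) ^+ i <= B) ->
  abs (ps_eval abs a c x - (trunc a n).[x - c]) <= B.
Proof.
move=> cv B0 hB; apply: (conv_abs_le (ps_evalP cv) (N := n)) => m nm.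
rewrite -psumE /psum -(subnKC nm) big_split_ord /= addrAC subrr add0r.
apply: abs_sum_le => // i _; rewrite absM absX; apply: hB; exact: leq_addr.
Qed.

(** The difference [u ^+ i - v ^+ i] is [u - v] times a sum of monomials of degree [i - 1] in [u]
    and [v], each at most [rho ^+ i.-1]; the ultrametric inequality ignores how many there are. *)
Lemma poly_lip (p : {poly K}) (rho B : R) (u v : K) : 0 < rho -> 0 <= B ->
  abs u <= rho -> abs v <= rho ->
  (forall i, (0 < i)%N -> abs p`_i * rho ^+ i <= B) ->
  abs (p.[u] - p.[v]) <= B / rho * abs (u - v).
Proof.
move=> r0 B0 ur vr hB; rewrite !horner_coef -sumrB.
have D0 : 0 <= B / rho * abs (u - v) by rewrite !mulr_ge0 ?invr_ge0 ?abs_ge0 // ltW.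
apply: abs_sum_le => // -[[|i] /= _] _; first by rewrite !expr0 subrr abs0.
rewrite -mulrBr subrXX !absM mulrCA mulrC; apply: ler_wpM2r; first exact: abs_ge0.
apply: (@le_trans _ _ (abs p`_i.+1 * rho ^+ i)).
  apply: ler_wpM2l; first exact: abs_ge0.
  apply: abs_sum_le => [|[j /= ji] _]; first by rewrite exprn_ge0 // ltW.
  rewrite absM !absX; have <- : (i - j + j)%N = i by rewrite subnK.
  rewrite addnK exprD; apply: ler_pM; rewrite ?exprn_ge0 ?abs_ge0 //.
    by apply: lerXn2r; rewrite ?nnegrE ?abs_ge0 // ltW.
  by apply: lerXn2r; rewrite ?nnegrE ?abs_ge0 // ltW.
by rewrite ler_pdivlMr // -mulrA -exprSr; exact: hB.
Qed.

Lemma coef_trunc (a : nat -> K) n i : (trunc a n)`_i = if (i < n)%N then a i else 0.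
Proof. exact: coef_poly. Qed.

Lemma abs_coef_trunc (a : nat -> K) n i : abs (trunc a n)`_i <= abs (a i).
Proof. by rewrite coef_trunc; case: ifP => // _; rewrite abs0 abs_ge0. Qed.

Lemma ps_lip (a : nat -> K) (c x y : K) (rho B : R) :
  ps_conv abs a c x -> ps_conv abs a c y -> 0 < rho -> 0 <= B ->
  abs (x - c) <= rho -> abs (y - c) <= rho ->
  (forall i, (0 < i)%N -> abs (a i) * rho ^+ i <= B) ->
  abs (ps_eval abs a c x - ps_eval abs a c y) <= B / rho * abs (x - y).
Proof.
move=> cx cy r0 B0 xr yr hB.
have := conv_to_sub (ps_evalP cx) (ps_evalP cy).
rewrite -[X in abs X <= _]subr0 => /(conv_abs_le (N := 0)); apply=> n _.
rewrite subr0 !psumE; have -> : x - y = (x - c) - (y - c) by ring.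
apply: poly_lip => // i i0; apply: le_trans (hB _ i0); apply: ler_wpM2r.
  by rewrite exprn_ge0 // ltW.
exact: abs_coef_trunc.
Qed.

Lemma ps_eval_center (a : nat -> K) (c : K) : ps_eval abs a c c = a 0%N.
Proof.
have cc : conv_to abs (psum a c c) (a 0%N).
  move=> e e0; exists 1%N => -[//|n] _.
  by rewrite psumE subrr horner_coef0 coef_trunc subrr abs0.
have /ps_evalP cv : ps_conv abs a c c by exists (a 0%N).
apply: eq_from_abs_lt => e e0.
have [N hN] := cc _ e0; have [M hM] := cv _ e0.
apply: (@abs_triangle_lt (psum a c c (maxn N M))).
  by rewrite absB; apply: hM; exact: leq_maxr.
by apply: hN; exact: leq_maxl.
Qed.

(* Vanishing to order n at 0, detected on small nonzero arguments of K. *)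
Lemma poly_small_coef (n : nat) (p : {poly K}) (C eta : R) : 0 < eta ->
  (forall h, h != 0 -> abs h < eta -> abs p.[h] <= C * abs h ^+ n) ->
  forall k, (k < n)%N -> p`_k = 0.
Proof.
elim: n p => [//|n IH] p eta0 hp k.
have [q pq] : exists q, p = q * 'X + (p`_0)%:P.
  have /factor_theorem[q] : root (p - (p`_0)%:P) 0.
    by rewrite /root !hornerE horner_coef0 subrr.
  by rewrite subr0 => pq; exists q; rewrite -pq subrK.
have C0 : 0 <= C.
  have [h h0 he] := abs_small_exists eta0.
  have := le_trans (abs_ge0 _) (hp h h0 he).
  by rewrite pmulr_lge0 // exprn_gt0 // abs_gt0.
have p0 : p`_0 = 0.
  apply: eq_from_abs_lt => e e0; rewrite subr0.
  pose A := C + \sum_(i < size q) abs q`_i + 1.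
  have S0 : 0 <= \sum_(i < size q) abs q`_i by apply: sumr_ge0 => i _; exact: abs_ge0.
  have A0 : 0 < A by rewrite /A; lra.
  have m0 : 0 < Num.min 1 (Num.min eta (e / A)) by rewrite !lt_min ltr01 eta0 divr_gt0.
  have [h h0] := abs_small_exists m0; rewrite !lt_min => /and3P[h1 he].
  rewrite ltr_pdivlMr // => hA.
  have hh : abs h ^+ n <= 1 by rewrite exprn_ile1 ?abs_ge0 // ltW.
  have -> : p`_0 = p.[h] - q.[h] * h by rewrite {2}pq !hornerE; ring.
  apply: absB_lt.
    apply: le_lt_trans (hp _ h0 he) _; apply: le_lt_trans hA.
    rewrite exprS mulrCA; apply: ler_wpM2l; first exact: abs_ge0.
    apply: (@le_trans _ _ C); last by rewrite /A; lra.
    by rewrite -[leRHS]mulr1; apply: ler_wpM2l.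
  rewrite absM mulrC; apply: le_lt_trans hA; apply: ler_wpM2l; first exact: abs_ge0.
  rewrite horner_coef; apply: abs_sum_le; first exact: ltW.
  move=> i _; rewrite absM absX; apply: (@le_trans _ _ (abs q`_i)).
    rewrite -[leRHS]mulr1; apply: ler_wpM2l; first exact: abs_ge0.
    by rewrite exprn_ile1 ?abs_ge0 // ltW.
  rewrite /A (bigD1 i) //=.
  have : 0 <= \sum_(j < size q | j != i) abs q`_j by apply: sumr_ge0 => j _; exact: abs_ge0.
  lra.
(* Now [p = q * 'X], and dividing the hypothesis by [abs h] gives it for [q] with order [n]. *)
case: k => [//|k] kn; rewrite pq coefD coefC addr0 coefMX /=.
apply: (IH q) => // h h0 he.
have := hp h h0 he; rewrite pq p0 addr0 !hornerE absM exprSr mulrA.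
by rewrite ler_pM2r // abs_gt0.
Qed.

(** * Gauss norms and dominant indices *)

(* [d] is the largest index at which the Gauss norm [A] of [p] on the disc of
   radius [rho] is attained. *)
Definition dominant (p : {poly K}) (rho A : R) (d : nat) : Prop :=
  [/\ forall k, abs p`_k * rho ^+ k <= A,
      forall k, (d < k)%N -> abs p`_k * rho ^+ k < A &
      abs p`_d * rho ^+ d = A].

Lemma dominant1 (rho : R) : dominant 1 rho 1 0.
Proof.
split=> [[|k]|[|k]|] //=; rewrite coef1 /= ?abs1 ?abs0 ?mul0r ?mul1r ?expr0 //.
Qed.

(** Gauss's lemma with indices: in degree [d + e], every pair other than [(d, e)] has a member
    beyond its dominant index, so a single term attains [A * B] and nothing can cancel it. *)
Lemma dominant_mul (p q : {poly K}) (rho A B : R) (d e : nat) :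
  0 < rho -> 0 < A -> 0 < B -> dominant p rho A d -> dominant q rho B e ->
  dominant (p * q) rho (A * B) (d + e).
Proof.
move=> r0 A0 B0 [p1 p2 p3] [q1 q2 q3].
pose F k (j : 'I_k.+1) := p`_j * q`_(k - j).
have FE k (j : 'I_k.+1) :
    abs (F k j) * rho ^+ k = (abs p`_j * rho ^+ j) * (abs q`_(k - j) * rho ^+ (k - j)).
  rewrite /F absM mulrACA -exprD subnKC //; exact: ltnSE (ltn_ord j).
have nn (r : {poly K}) i : 0 <= abs r`_i * rho ^+ i.
  by rewrite mulr_ge0 ?abs_ge0 // exprn_ge0 // ltW.
have Fle k j : abs (F k j) * rho ^+ k <= A * B by rewrite FE; apply: ler_pM.
have Flt k (j : 'I_k.+1) : (d < j)%N || (e < k - j)%N -> abs (F k j) * rho ^+ k < A * B.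
  rewrite FE => /orP[/p2 h|/q2 h].
    apply: (@le_lt_trans _ _ (abs p`_j * rho ^+ j * B)); first exact: ler_wpM2l.
    by rewrite ltr_pM2r.
  apply: (@le_lt_trans _ _ (A * (abs q`_(k - j) * rho ^+ (k - j)))); first exact: ler_wpM2r.
  by rewrite ltr_pM2l.
have rk k : 0 < rho ^+ k by exact: exprn_gt0.
split=> [k|k dek|].
- rewrite coefM -ler_pdivlMr //; apply: abs_sum_le => [|j _].
    by rewrite ltW // divr_gt0 // mulr_gt0.
  by rewrite ler_pdivlMr //; exact: Fle.
- rewrite coefM -ltr_pdivlMr //; apply: abs_sum_lt => [|j _].
    by rewrite divr_gt0 // mulr_gt0.
  by rewrite ltr_pdivlMr //; apply: Flt; lia.
- have dlt : (d < (d + e).+1)%N by rewrite ltnS leq_addr.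
  have Fd : abs (F _ (Ordinal dlt)) * rho ^+ (d + e) = A * B.
    by rewrite FE /= addKn p3 q3.
  have Fd0 : 0 < abs (F _ (Ordinal dlt)).
    by rewrite -(pmulr_lgt0 _ (rk (d + e)%N)) Fd mulr_gt0.
  rewrite coefM (abs_sum_dom (j := Ordinal dlt)) // => j jd.
  rewrite -(ltr_pM2r (rk (d + e)%N)) Fd; apply: Flt.
  have : (j : nat) != d by apply: contraNneq jd => jd; apply/eqP/val_inj.
  have := ltn_ord j; lia.
Qed.

Lemma dominant_exp (p : {poly K}) (rho A : R) (d n : nat) :
  0 < rho -> 0 < A -> dominant p rho A d -> dominant (p ^+ n) rho (A ^+ n) (d * n).
Proof.
move=> r0 A0 pd; elim: n => [|n IH]; first by rewrite muln0 !expr0; exact: dominant1.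
by rewrite !exprS mulnS; apply: dominant_mul => //; exact: exprn_gt0.
Qed.

(** In degree [d * m] only the summand [i = m] attains [tau]: for [i > m] the coefficient of [p] is
    too small, and for [i < m] the degree lies beyond the dominant index [d * i] of [q ^+ i], as
    [0 < d]. *)
Lemma comp_dominant (p q : {poly K}) (rho sigma tau : R) (d m : nat) :
  0 < rho -> 0 < sigma -> 0 < tau -> (0 < d)%N ->
  dominant q rho sigma d -> dominant p sigma tau m ->
  abs (p \Po q)`_(d * m) * rho ^+ (d * m) = tau.
Proof.
move=> r0 s0 t0 d0 qd [p1 p2 p3].
have pm0 : p`_m != 0 by rewrite -(abs_eq0); apply/eqP => h; move: t0; rewrite -p3 h mul0r ltxx.
have ms : (m < size p)%N by rewrite ltnNge; apply: contra pm0 => /leq_sizeP ->.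
have rk : 0 < rho ^+ (d * m) by exact: exprn_gt0.
pose F (i : 'I_(size p)) := p`_i * (q ^+ i)`_(d * m).
have Fm : abs (F (Ordinal ms)) * rho ^+ (d * m) = tau.
  have [_ _ h] := dominant_exp m r0 s0 qd.
  by rewrite /F /= absM -mulrA h p3.
rewrite coef_comp_poly (abs_sum_dom (j := Ordinal ms)) //.
  by rewrite -(pmulr_lgt0 _ rk) Fm.
move=> i im; rewrite -(ltr_pM2r rk) Fm absM -mulrA.
have [h1 h2 _] := dominant_exp i r0 s0 qd.
have [mi|im'|im'] := ltngtP m i; last by case/eqP: im; apply: val_inj.
  by apply: le_lt_trans (p2 _ mi); apply: ler_wpM2l => //; exact: abs_ge0.
have [->|pi0] := eqVneq p`_i 0; first by rewrite abs0 mul0r.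
apply: lt_le_trans (p1 i); rewrite ltr_pM2l ?abs_gt0 //; apply: h2.
by rewrite ltn_pmul2l.
Qed.

Lemma geom_terms_le (a r s B : R) (n i : nat) : 0 <= a -> 0 <= r -> r <= s -> 0 < s ->
  a * s ^+ i <= B -> (n <= i)%N -> a * r ^+ i <= B * (r / s) ^+ n.
Proof.
move=> a0 r0 rs s0 asB ni.
have q0 : 0 <= r / s by rewrite divr_ge0 // ltW.
have q1 : r / s <= 1 by rewrite ler_pdivrMr // mul1r.
have -> : a * r ^+ i = (a * s ^+ i) * (r / s) ^+ i.
  by rewrite -mulrA -exprMn mulrCA divff ?mulr1 ?gt_eqF.
apply: ler_pM => //; first by rewrite mulr_ge0 // exprn_ge0 // ltW.
  exact: exprn_ge0.
exact: ler_wiXn2l.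
Qed.

(** * The formal conjugacy and the coefficient bound for [f] *)

(** The constant term of [fa] is the centre; without it the series represents [f(x) - x0] in the
    variable [x - x0], into which [ga] can be composed. *)
Definition nocst (a : nat -> K) (i : nat) : K := if i is 0 then 0 else a i.

(* Comparing orders of vanishing at [x0] turns g o f = lam g into an identity of
   formal power series. *)
Lemma formal_conj (fa ga : nat -> K) (lam x0 : K) (rho C : R) (N : nat) :
  fa 0%N = x0 -> abs lam = 1 -> 0 < rho -> 0 <= C ->
  (forall i, (0 < i)%N -> abs (fa i) * rho ^+ i <= rho) ->
  (forall i, abs (ga i) * rho ^+ i <= C) ->
  (forall x, abs (x - x0) <= rho ->
     [/\ ps_conv abs fa x0 x, ps_conv abs ga x0 x,
         ps_conv abs ga x0 (ps_eval abs fa x0 x) &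
         ps_eval abs ga x0 (ps_eval abs fa x0 x) = lam * ps_eval abs ga x0 x]) ->
  forall k, (k <= N)%N -> (trunc ga N.+1 \Po trunc (nocst fa) N.+1)`_k = lam * ga k.
Proof.
move=> fa0 lam1 r0 C0 fr gr conj k kN.
set G := trunc ga N.+1; set F := trunc (nocst fa) N.+1.
suff : (G \Po F - lam *: G)`_k = 0.
  by rewrite coefB coefZ coef_trunc ltnS kN => /eqP; rewrite subr_eq0 => /eqP.
apply: (@poly_small_coef N.+1 _ (C / rho ^+ N.+1) rho) => // h _ hr.
have {}hr := ltW hr; have h0 := abs_ge0 h.
have xh : x0 + h - x0 = h by rewrite addrAC subrr add0r.
have [] := conj (x0 + h); rewrite ?xh // => cf cg cgf fg.
set y := ps_eval abs fa x0 (x0 + h) in cgf fg.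
have tF : (trunc fa N.+1).[h] = F.[h] + x0.
  have -> : trunc fa N.+1 = F + x0%:P.
    apply/polyP => -[|i]; rewrite coefD coefC !coef_trunc /=; first by rewrite fa0 add0r.
    by rewrite addr0.
  by rewrite !hornerE.
have fh i : (0 < i)%N -> abs (fa i) * abs h ^+ i <= abs h.
  move=> i0; rewrite -[leRHS](divfK (x := rho)) ?gt_eqF // [leRHS]mulrC -[abs h / rho]expr1.
  by apply: geom_terms_le => //; [exact: abs_ge0|exact: fr].
have Fh : abs F.[h] <= abs h.
  rewrite /F horner_poly; apply: abs_sum_le => // -[[|i] /= _] _.
    by rewrite mul0r abs0.
  by rewrite absM absX; exact: fh.
have yh : abs (y - x0) <= abs h.
  have -> : y - x0 = y - (trunc fa 1).[x0 + h - x0].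
    by rewrite horner_poly big_ord1 expr0 mulr1 fa0.
  by apply: ps_tail => // i i0; rewrite xh; exact: fh.
set B := C / rho ^+ N.+1 * abs h ^+ N.+1.
have BE : B = C * (abs h / rho) ^+ N.+1 by rewrite /B expr_div_n; ring.
have B0 : 0 <= B by rewrite BE mulr_ge0 // exprn_ge0 // divr_ge0 // ltW.
have gtail x : abs (x - x0) <= abs h -> ps_conv abs ga x0 x ->
    abs (ps_eval abs ga x0 x - G.[x - x0]) <= B.
  move=> xle cx; apply: ps_tail => // i Ni.
  apply: (@le_trans _ _ (abs (ga i) * abs h ^+ i)); first by apply: terms_le; rewrite ?abs_ge0.
  by rewrite BE; apply: geom_terms_le => //; exact: abs_ge0.
rewrite hornerD hornerN hornerZ horner_comp.
(* The exact values cancel by [fg]. What remains are three errors of size at most [B]: truncating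
   [f] inside [G], and the tails of [g] at [y] and at [x0 + h]. *)
have -> : G.[F.[h]] - lam * G.[h] = (G.[F.[h]] - G.[y - x0])
     - ((ps_eval abs ga x0 y - G.[y - x0]) - lam * (ps_eval abs ga x0 (x0 + h) - G.[h])).
  by rewrite fg; ring.
apply: absB_le.
  apply: (@le_trans _ _ (C / rho * abs (F.[h] - (y - x0)))).
    apply: poly_lip => //; try exact: le_trans hr.
    move=> i _; apply: le_trans (gr i); apply: ler_wpM2r; last exact: abs_coef_trunc.
    by rewrite exprn_ge0 // ltW.
  rewrite BE -mulrA; apply: ler_wpM2l => //; rewrite mulrC ler_pdivrMr //.
  have -> : F.[h] - (y - x0) = - (y - (trunc fa N.+1).[x0 + h - x0]) by rewrite xh tF; ring.
  rewrite absN mulrC; apply: ps_tail => //.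
    by rewrite mulr_ge0 ?exprn_ge0 ?divr_ge0 // ltW.
  move=> i Ni; rewrite xh; apply: geom_terms_le => //; first exact: abs_ge0.
  by apply: fr; exact: leq_trans Ni.
apply: absB_le; first exact: gtail.
by rewrite absM lam1 mul1r -{2}xh; apply: gtail; rewrite ?xh.
Qed.

(** The linear term equals the radius, and higher terms shrink faster with it. With [C] bounding the
    terms at [x], it is enough that [t ^+ k] reach [C / abs (x - c)]. *)
Lemma small_radius (a : nat -> K) (c x : K) (t : R) : 1 < t -> x != c ->
  ps_conv abs a c x -> abs (a 1%N) = 1 ->
  exists k : nat, forall i, (0 < i)%N ->
    abs (a i) * (abs (x - c) / t ^+ k) ^+ i <= abs (x - c) / t ^+ k.
Proof.
move=> t1 xc cv a1; have [C C0 hC] := ps_conv_bounded cv.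
have r0 : 0 < abs (x - c) by rewrite abs_gt0 subr_eq0.
have [k hk] := expr_unbounded (C / abs (x - c)) t1.
exists k => -[//|[|i]] _; first by rewrite a1 expr1 mul1r.
have tk : 0 < t ^+ k by rewrite exprn_gt0 //; lra.
have tk1 : 1 <= t ^+ k by rewrite exprn_ege1 // ltW.
rewrite expr_div_n mulrA ler_pdivrMr ?exprn_gt0 //; last lra.
apply: le_trans (hC _) _.
rewrite exprS mulrA divfK ?gt_eqF // mulrC -ler_pdivrMr //; apply: le_trans hk _.
by rewrite exprS -[leLHS]mulr1; apply: ler_wpM2l; rewrite ?exprn_ege1 // ltW.
Qed.

Lemma last_failure (P : nat -> Prop) (n : nat) : ~ P 0%N -> P n ->
  exists k, ~ P k /\ P k.+1.
Proof.
move=> P0; elim: n => [//|n IH] Pn; have [/IH //|nPn] := classic (P n).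
by exists n.
Qed.
(* If the bound failed, some radius [rho] would have Gauss norm
   [sigma = |f|_rho > rho] with [sigma] at most [|x - x0|]; then
   [|g o f|_rho = |g|_sigma > |g|_rho], contradicting [g o f = lam g]. *)
Lemma conj_coef_bound (fa ga : nat -> K) (c x : K) :
  x != c -> ps_conv abs fa c x -> ps_conv abs ga c x ->
  abs (fa 1%N) = 1 -> ga 0%N = 0 -> abs (ga 1%N) = 1 ->
  (forall N k, (k <= N)%N ->
     abs (trunc ga N.+1 \Po trunc (nocst fa) N.+1)`_k = abs (ga k)) ->
  forall i, (0 < i)%N -> abs (fa i) * abs (x - c) ^+ i <= abs (x - c).
Proof.
move=> xc cf cg f1 g0 g1 fg i0 i0_gt0; rewrite leNgt; apply/negP => bad.
set r := abs (x - c) in bad.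
have r0 : 0 < r by rewrite abs_gt0 subr_eq0.
have [N0 hN0] := ps_conv_terms cf r0.
have [j0 i0E] : exists j0, i0 = j0.+2.
  case: i0 i0_gt0 bad => [//|[_|j _ _]]; last by exists j.
  by rewrite f1 expr1 mul1r ltxx.
have q1 : 1 < abs (fa i0) * r ^+ i0 / r by rewrite ltr_pdivlMr // mul1r.
(* The ratio [t] is so close to 1 that a radius [r / t ^+ k] satisfying the bound at [i0] must have
   [N0 <= k]: the bound there says that the excess ratio of [q1] is at most [t ^+ (k * i0.-1)]. *)
have [t t1 tq] := small_root (N0 * i0.-1) q1.
have t0 : 0 < t by lra.
pose P k := forall i, (0 < i)%N -> abs (fa i) * (r / t ^+ k) ^+ i <= r / t ^+ k.
(* Two neighbouring radii: the bound fails at [rho] and holds at [u = rho / t]. Hence [sigma] below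
   exceeds [rho], but by a controlled amount. *)
have [k [nPk PSk]] : exists k, ~ P k /\ P k.+1.
  have [n Pn] := small_radius t1 xc cf f1.
  apply: (last_failure _ Pn) => P0; have := P0 _ i0_gt0.
  by rewrite expr0 divr1 leNgt bad.
have tk j : 0 < t ^+ j by exact: exprn_gt0.
set u := r / t ^+ k.+1; pose rho := r / t ^+ k.
have rho0 : 0 < rho by rewrite divr_gt0.
have rhor : rho <= r by rewrite ler_pdivrMr // -[leLHS]mulr1 ler_pM2l // exprn_ege1 // ltW.
have rhoE : rho = u * t by rewrite /rho /u exprSr invfM mulrA divfK ?gt_eqF.
have u0 : 0 < u by rewrite divr_gt0.
have N0k : (N0 <= k.+1)%N.
  rewrite leqNgt; apply/negP => kN0.
  have := PSk _ i0_gt0; rewrite expr_div_n mulrA ler_pdivrMr ?exprn_gt0 //.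
  rewrite [in leRHS]i0E [_ ^+ j0.+2]exprS mulrA divfK ?gt_eqF // [leRHS]mulrC -ler_pdivrMr // => qle.
  have := le_trans tq qle; rewrite -exprM ler_eXn2l // i0E /=.
  by rewrite leq_pmul2r // leqNgt kN0.
have [i1 [i1_gt0 i1rho]] : exists i, (0 < i)%N /\ rho < abs (fa i) * rho ^+ i.
  apply: NNPP => h; apply: nPk => i ip; rewrite leNgt; apply/negP => hi.
  by apply: h; exists i.
pose b i := abs (nocst fa i) * rho ^+ i.
have nocstE i : (0 < i)%N -> nocst fa i = fa i by case: i.
have [d [bd bdlt]] : exists d, (forall i, b i <= b d) /\ (forall i, (d < i)%N -> b i < b d).
  apply: (@top_dominant _ _ i1); last by rewrite /b nocstE // (lt_trans rho0).
  move=> e e0; have [N hN] := ps_conv_terms cf e0; exists N.+1 => i Ni.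
  rewrite /b nocstE; last by apply: leq_trans Ni.
  by apply: le_lt_trans (hN i (ltnW Ni)); apply: terms_le; rewrite ?abs_ge0 // ltW.
set sigma := b d in bd bdlt.
have rs : rho < sigma by apply: lt_le_trans (bd i1); rewrite /b nocstE.
have s0 := lt_trans rho0 rs.
have d0 : (0 < d)%N.
  by rewrite lt0n; apply/eqP => dE; move: s0; rewrite /sigma /b dE /= abs0 mul0r ltxx.
(* If [N0 <= d], the choice of [N0] bounds the term even at radius [r]. Otherwise the bound at [u]
   loses only [t ^+ d], at most [t ^+ k.+1], which brings [u] back to [r]. *)
have sr : sigma <= r.
  rewrite /sigma /b nocstE //; have [Nd|dN] := leqP N0 d.
    by apply: le_trans (ltW (hN0 _ Nd)); apply: terms_le; rewrite ?abs_ge0 // ltW.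
  rewrite rhoE exprMn mulrA.
  apply: (@le_trans _ _ (u * t ^+ k.+1)); last by rewrite /u divfK ?gt_eqF.
  apply: ler_pM; last 2 first.
  - exact: PSk.
  - by rewrite ler_eXn2l //; exact: ltnW (leq_trans dN N0k).
  - by rewrite mulr_ge0 ?abs_ge0 // exprn_ge0 // ltW.
  - by rewrite exprn_ge0 // ltW.
pose a i := abs (ga i) * sigma ^+ i.
have [m [am amlt]] : exists m, (forall i, a i <= a m) /\ (forall i, (m < i)%N -> a i < a m).
  apply: (@top_dominant _ _ 1%N); last by rewrite /a g1 mul1r expr1.
  move=> e e0; have [N hN] := ps_conv_terms cg e0; exists N => i Ni.
  by apply: le_lt_trans (hN i Ni); apply: terms_le; rewrite ?abs_ge0 // ltW.
set tau := a m in am amlt.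
have tau0 : 0 < tau by apply: lt_le_trans (am 1%N); rewrite /a g1 mul1r expr1.
have m0 : (0 < m)%N.
  by rewrite lt0n; apply/eqP => mE; move: tau0; rewrite /tau /a mE g0 abs0 mul0r ltxx.
(* Length [(d * m).+1] keeps the dominant indices [d] and [m] as well as the coefficient [d * m] of
   the composite. *)
have domf : dominant (trunc (nocst fa) (d * m).+1) rho sigma d.
  split=> [i|i di|].
  - apply: le_trans (bd i); apply: ler_wpM2r; last exact: abs_coef_trunc.
    by rewrite exprn_ge0 // ltW.
  - apply: le_lt_trans (bdlt i di); apply: ler_wpM2r; last exact: abs_coef_trunc.
    by rewrite exprn_ge0 // ltW.
  - by rewrite coef_trunc ltnS leq_pmulr.
have domg : dominant (trunc ga (d * m).+1) sigma tau m.
  split=> [i|i mi|].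
  - apply: le_trans (am i); apply: ler_wpM2r; last exact: abs_coef_trunc.
    by rewrite exprn_ge0 // ltW.
  - apply: le_lt_trans (amlt i mi); apply: ler_wpM2r; last exact: abs_coef_trunc.
    by rewrite exprn_ge0 // ltW.
  - by rewrite coef_trunc ltnS leq_pmull.
have := comp_dominant rho0 s0 tau0 d0 domf domg.
rewrite fg // => tauE.
have [gz|gnz] := eqVneq (ga (d * m)%N) 0.
  by move: tau0; rewrite -tauE gz abs0 mul0r ltxx.
(* This coefficient contributes at most [tau] at radius [sigma], hence strictly less at
   [rho < sigma], while [tauE] gives exactly [tau]. *)
have : abs (ga (d * m)%N) * rho ^+ (d * m) < tau.
  apply: lt_le_trans (am (d * m)%N); rewrite /a ltr_pM2l ?abs_gt0 //.
  by rewrite ltrXn2r ?ltW // muln_eq0 negb_or -!lt0n d0.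
by rewrite tauE ltxx.
Qed.

(** * Separated points and continuity of the inverse of [g] *)

(* Divided differences: each step replaces [p] by [(p - p(u)) / ('X - u)], which
   lowers the dominant index by one and keeps the dominant coefficient. *)
Lemma poly_separated (d : nat) (p : {poly K}) (rho eta : R) (us : seq K) :
  0 < rho -> 0 < eta ->
  (forall j, (d < j)%N -> abs p`_j * rho ^+ j < abs p`_d * rho ^+ d) ->
  size us = d.+1 -> (forall u, u \in us -> abs u <= rho) ->
  pairwise (fun u v => eta <= abs (u - v)) us ->
  exists2 u, u \in us & abs p`_d * eta ^+ d <= abs p.[u].
Proof.
move=> r0 e0; have nn (q : {poly K}) i : 0 <= abs q`_i * rho ^+ i.
  by rewrite mulr_ge0 ?abs_ge0 // exprn_ge0 // ltW.
elim: d p us => [|d IH] p us pdom.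
  case: us => [//|u [|//]] _ ur _; exists u; rewrite ?mem_head // expr0 mulr1.
  have {}ur := ur u (mem_head _ _).
  rewrite expr0 mulr1 in pdom.
  have p0 : 0 < abs p`_0 by exact: le_lt_trans (nn p 1%N) (pdom 1%N isT).
  have sp : (0 < size p)%N.
    by rewrite lt0n size_poly_eq0; apply: contraTneq p0 => ->; rewrite coef0 abs0 ltxx.
  rewrite horner_coef (abs_sum_dom (j := Ordinal sp)) /= ?expr0 ?mulr1 //.
  move=> [[|i] /= ip] //= _; rewrite ?expr0 ?mulr1 absM absX.
  apply: le_lt_trans (pdom i.+1 isT).
  by apply: terms_le; rewrite ?abs_ge0.
case: us => [//|u us] [us_size] usr; rewrite pairwise_cons => /andP[/allP usep uspw].
have ur : abs u <= rho by apply: usr; rewrite mem_head.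
have [q pq] : exists q, p - p.[u]%:P = q * ('X - u%:P).
  by apply/factor_theorem; rewrite /root !hornerE subrr.
have qE j : q`_j = p`_j.+1 + q`_j.+1 * u.
  have := congr1 (fun r : {poly K} => r`_j.+1) pq.
  by rewrite coefB coefC subr0 mulrBr coefB coefMX coefMC /= => ->; rewrite subrK.
set A := abs p`_d.+1 * rho ^+ d.+1 in pdom.
have A0 : 0 < A by apply: le_lt_trans (nn p d.+2) (pdom _ _).
have qu j : abs (q`_j.+1 * u) * rho ^+ j.+1 <= abs q`_j.+1 * rho ^+ j.+2.
  rewrite absM [rho ^+ j.+2]exprS mulrA; apply: ler_wpM2r; first by rewrite exprn_ge0 // ltW.
  by apply: ler_wpM2l => //; exact: abs_ge0.
have rk k : 0 < rho ^+ k by exact: exprn_gt0.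
(* Downward induction on [j] through [qE], starting beyond the size of [q], where coefficients
   vanish. *)
have far n j : (size q <= j + n)%N -> (d < j)%N -> abs q`_j * rho ^+ j.+1 < A.
  elim: n j => [|n IHn] j; first by rewrite addn0 => /leq_sizeP ->; rewrite // abs0 mul0r.
  move=> qjn dj; rewrite qE -ltr_pdivlMr //; apply: absD_lt; rewrite ltr_pdivlMr //.
    exact: pdom.
  by apply: le_lt_trans (qu j) _; apply: IHn; [rewrite addSnnS|exact: leqW].
have qd : abs q`_d = abs p`_d.+1.
  rewrite qE absD_dom // -(ltr_pM2r (rk d.+1)) -/A.
  by apply: le_lt_trans (qu d) _; exact: far (leq_addl _ _) _.
have [||w wus qw] := IH q us _ us_size _ uspw.
- move=> j dj; rewrite -(ltr_pM2r r0) -!mulrA -!exprSr qd; exact: far (leq_addl _ _) _.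
- by move=> w wus; apply: usr; rewrite inE wus orbT.
have [pu|pu] := leP (abs p`_d.+1 * eta ^+ d.+1) (abs p.[u]).
  by exists u; rewrite ?mem_head.
exists w; first by rewrite inE wus orbT.
have := congr1 (fun r : {poly K} => r.[w]) pq.
rewrite !hornerE => pw; rewrite leNgt; apply/negP => pw'.
have := absB_lt pw' pu; rewrite pw absM ltNge => /negP; apply.
rewrite exprSr mulrA -qd; apply: ler_pM => //.
- by rewrite mulr_ge0 ?abs_ge0 // exprn_ge0 // ltW.
- exact: ltW.
- by rewrite absB; exact: usep.
Qed.

Hypothesis hcomp : complete_abs abs.

(** The points [A del x] refute the modulus [del]. The finiteness in [few] makes them totally
    bounded as [del] shrinks, and with [hcomp] this replaces local compactness of [K]. *)
Lemma ps_inverse_continuous (a : nat -> K) (c x1 z : K) (e : R) :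
  x1 != c -> a 0%N = 0 -> a 1%N != 0 ->
  (forall x, abs (x - c) <= abs (x1 - c) -> ps_conv abs a c x) ->
  (forall x y, abs (x - c) <= abs (x1 - c) -> abs (y - c) <= abs (x1 - c) ->
     ps_eval abs a c x = ps_eval abs a c y -> x = y) ->
  abs (z - c) <= abs (x1 - c) -> 0 < e ->
  exists2 del, 0 < del & forall x, abs (x - c) <= abs (x1 - c) ->
    abs (ps_eval abs a c x - ps_eval abs a c z) < del -> abs (x - z) < e.
Proof.
move=> x1c a0 a1 cv inj zr e0; set r := abs (x1 - c) in cv inj zr *.
have r0 : 0 < r by rewrite abs_gt0 subr_eq0.
have cx1 := cv x1 (lexx _).
set g := ps_eval abs a c in inj *.
apply: NNPP => noinv.
pose A del x := [/\ abs (x - c) <= r, abs (g x - g z) < del & e <= abs (x - z)].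
have Aex del : 0 < del -> exists x, A del x.
  move=> del0; apply: NNPP => h; apply: noinv; exists del => // x xr gx.
  by rewrite ltNge; apply/negP => ex; apply: h; exists x.
have [d [_ adlt]] : exists d, (forall i, abs (a i) * r ^+ i <= abs (a d) * r ^+ d) /\
    (forall i, (d < i)%N -> abs (a i) * r ^+ i < abs (a d) * r ^+ d).
  apply: (@top_dominant _ (fun i => abs (a i) * r ^+ i) 1%N).
    exact: ps_conv_terms cx1.
  by rewrite expr1 mulr_gt0 // abs_gt0.
have ad0 : 0 < abs (a d).
  rewrite -(pmulr_lgt0 _ (exprn_gt0 d r0)); apply: le_lt_trans (adlt d.+1 (ltnSn d)).
  by rewrite mulr_ge0 ?abs_ge0 // exprn_ge0 // ltW.
have d0 : (0 < d)%N.
  by rewrite lt0n; apply: contraTneq ad0 => ->; rewrite a0 abs0 ltxx.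
have few eta us : 0 < eta -> size us = d.+1 ->
    (forall u, u \in us -> A (abs (a d) * eta ^+ d) u) ->
    pairwise (fun u v => eta <= abs (u - v)) us -> False.
  move=> eta0 szus usA uspw.
  have del0 : 0 < abs (a d) * eta ^+ d by rewrite mulr_gt0 // exprn_gt0.
  (* Half of the threshold, because [ps_tail] gives a non-strict bound; [n] exceeds [d] so that the
     truncation keeps [a d]. *)
  have [N hN] := ps_conv_terms cx1 (half_gt0 del0).
  set n := maxn N d.+1; pose p := trunc a n - (g z)%:P.
  have pE j : (0 < j)%N -> p`_j = (trunc a n)`_j by case: j => // j _; rewrite coefB coefC subr0.
  have pd : p`_d = a d by rewrite pE // coef_trunc leq_maxr.
  have [||||v /mapP[u uus ->]] := @poly_separated d p r eta (map (fun u => u - c) us) r0 eta0.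
  - move=> j dj; rewrite pd pE ?(leq_trans _ dj) //; apply: le_lt_trans (adlt _ dj).
    by apply: ler_wpM2r; [rewrite exprn_ge0 // ltW|exact: abs_coef_trunc].
  - by rewrite size_map.
  - by move=> _ /mapP[u /usA[? _ _] ->].
  - rewrite pairwise_map; apply: sub_pairwise uspw => u v /=.
    by rewrite opprB addrA subrK.
  have [ur gu _] := usA u uus.
  rewrite pd leNgt => /negP; apply.
  have -> : p.[u - c] = (g u - g z) - (g u - (trunc a n).[u - c]) by rewrite !hornerE; ring.
  apply: absB_lt => //; apply: le_lt_trans (half_lt del0).
  apply: ps_tail; [exact: cv|exact/ltW/half_gt0|move=> i ni].
  apply: le_trans (ltW (hN i (leq_trans (leq_maxl _ _) ni))).
  by apply: terms_le; rewrite ?abs_ge0.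
pose good k eta := forall del, 0 < del -> exists x, A del x /\ abs (x - k) < eta.
(* Were every [k'] in the ball isolated at scale [eta'], shrinking [del] after each choice would
   greedily produce [d.+1] separated points, against [few]. *)
have refine k eta eta' : good k eta -> 0 < eta' -> eta' <= eta ->
    exists k', abs (k' - k) < eta /\ good k' eta'.
  move=> gk eta'0 eta'eta; apply: NNPP => h.
  have isol k' : abs (k' - k) < eta -> exists2 del, 0 < del &
      forall x, A del x -> eta' <= abs (x - k').
    move=> k'k; apply: NNPP => h'; apply: h; exists k'; split=> // del del0.
    apply: NNPP => h2; apply: h'; exists del => // x Ax; rewrite leNgt; apply/negP => xk'.
    by apply: h2; exists x.
  set del0 := abs (a d) * eta' ^+ d.
  have del0_gt0 : 0 < del0 by rewrite mulr_gt0 // exprn_gt0.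
  have greedy n : exists us del, [/\ size us = n /\ 0 < del, del <= del0,
      (forall u, u \in us -> A del0 u),
      pairwise (fun u v => eta' <= abs (u - v)) us &
      (forall x u, A del x -> u \in us -> eta' <= abs (x - u))].
    elim: n => [|n [us [del [[szus del_gt0] delle usA uspw usfar]]]]; first by exists [::], del0.
    have [x [Ax xk]] := gk _ del_gt0.
    have [del1 del1_gt0 hx] := isol x xk.
    exists (x :: us), (Num.min del del1); split.
    - by rewrite /= szus lt_min del_gt0.
    - by rewrite ge_min delle.
    - move=> u; rewrite inE => /orP[/eqP ->|/usA//].
      by case: Ax => ? gx ?; split=> //; exact: lt_le_trans gx delle.
    - by rewrite pairwise_cons uspw andbT; apply/allP => u; exact: usfar.
    - move=> y u [yr + ey]; rewrite lt_min => /andP[gy gy1].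
      by rewrite inE => /orP[/eqP ->|]; [exact: hx|exact: usfar].
  have [us [del [[szus _] _ usA uspw _]]] := greedy d.+1.
  exact: few eta'0 szus usA uspw.
(* Starting at [r + 1] puts all refuting points strictly inside the first ball, centred at [c]. *)
pose eta n := (r + 1) / 2 ^+ n.
have eta0 n : 0 < eta n by rewrite divr_gt0 ?exprn_gt0 //; lra.
have etaS n m : (n <= m)%N -> eta m <= eta n.
  move=> nm; rewrite ler_pM2l; last by lra.
  by rewrite lef_pV2 ?posrE ?exprn_gt0 // ler_eXn2l //; lra.
have eta_small e' : 0 < e' -> exists n, eta n < e'.
  move=> e'0; have two : 1 < 2 :> R by lra.
  have [n hn] := expr_unbounded ((r + 1) / e' + 1) two.
  exists n; rewrite ltr_pdivrMr ?exprn_gt0 // mulrC -ltr_pdivrMr //.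
  by apply: lt_le_trans hn; lra.
pose next n k := epsilon (inhabits 0) (fun k' => abs (k' - k) < eta n /\ good k' (eta n.+1)).
pose ks := fix ks n := if n is n'.+1 then next n' (ks n') else c.
have ks_good n : good (ks n) (eta n).
  elim: n => [|n IHn] /=.
    move=> del /Aex[x Ax]; exists x; split=> //; case: Ax => xr _ _.
    by rewrite /eta expr0 divr1; lra.
  by have [] := epsilon_spec (inhabits 0) _ (refine _ _ _ IHn (eta0 n.+1) (etaS _ _ (leqnSn n))).
have ks_step n : abs (ks n.+1 - ks n) < eta n.
  by have [] := epsilon_spec (inhabits 0) _
    (refine _ _ _ (ks_good n) (eta0 n.+1) (etaS _ _ (leqnSn n))).
have ks_near n m : (n <= m)%N -> abs (ks m - ks n) < eta n.
  elim: m => [|m IHm]; first by rewrite leqn0 => /eqP ->; rewrite subrr abs0.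
  rewrite leq_eqVlt => /orP[/eqP ->|]; first by rewrite subrr abs0.
  rewrite ltnS => nm; apply: (@abs_triangle_lt (ks m)); last exact: IHm nm.
  exact: lt_le_trans (ks_step m) (etaS _ _ nm).
have [l ksl] : exists l, conv_to abs ks l.
  apply: hcomp => e' /eta_small[n hn]; exists n => i j ni nj.
  apply: lt_trans hn; apply: (@abs_triangle_lt (ks n)); first exact: ks_near.
  by rewrite absB; exact: ks_near.
have l_near e' del : 0 < e' -> 0 < del -> exists x, A del x /\ abs (x - l) < e'.
  move=> /eta_small[n hn] del0; have [x [Ax xk]] := ks_good n _ del0.
  exists x; split=> //; apply: lt_trans hn.
  have [N hN] := ksl _ (eta0 n).
  apply: (@abs_triangle_lt (ks n)) => //; rewrite absB.
  apply: (@abs_triangle_lt (ks (maxn n N))).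
    by rewrite absB; apply: hN; exact: leq_maxr.
  by apply: ks_near; exact: leq_maxl.
have lr : abs (l - c) <= r.
  have [x [[xr _ _] xl]] := l_near _ _ r0 ltr01.
  by apply: (@abs_triangle_le x) => //; rewrite absB ltW.
have lz : e <= abs (l - z).
  rewrite leNgt; apply/negP => lze.
  have [x [[_ _]]] := l_near _ _ e0 ltr01.
  by rewrite leNgt => /negP xz xl; apply: xz; exact: abs_triangle_lt xl lze.
have [C C0 hC] := ps_conv_bounded cx1.
have glz : g l = g z.
  apply: eq_from_abs_lt => del del0.
  have Cr0 : 0 < C / r by rewrite divr_gt0.
  have [x [[xr gx _] xl]] := l_near _ _ (divr_gt0 del0 Cr0) del0.
  apply: (@abs_triangle_lt (g x)) => //.
  apply: le_lt_trans (ps_lip (cv _ lr) (cv _ xr) r0 (ltW C0) lr xr (fun i _ => hC i)) _.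
  by rewrite mulrC -ltr_pdivlMr // absB.
by move: lz; rewrite (inj l z lr zr glz) subrr abs0 leNgt e0.
Qed.
End AbsoluteValue.

(** * Transfer of orbits through [g], recurrence and minimality *)

Theorem theoremG (R : realType) (K : fieldType) (abs : K -> R)
  (habs : nonarch_abs abs) (hcomp : complete_abs abs)
  (x0 lam : K) (fa ga : nat -> K) (D X : K -> Prop) :
  fa 0%N = x0 -> fa 1%N = lam ->
  abs lam = 1 -> (forall n, (0 < n)%N -> lam ^+ n != 1) ->
  ga 0%N = 0 -> abs (ga 1%N) = 1 ->
  lin_disc abs fa ga lam x0 D ->
  (forall x, X x -> D x) ->
  (forall x, X x -> X (ps_eval abs fa x0 x)) ->
  let f := ps_eval abs fa x0 in
  let g := ps_eval abs ga x0 in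
  (transitive_on abs f X <-> transitive_on abs (fun w => lam * w) (img g X)) /\
  (compact_set abs X -> transitive_on abs f X ->
     [/\ minimal_on abs f X,
         (forall y, img f X y <-> X y) &
         (forall w, img g X w <-> img (fun w => lam * w) (img g X) w)]).
Proof.
move=> fa0 fa1 lam1 _ ga0 ga1 [Ddisc _ [Dg Dinj Df] _] XD Xf f g.
have two : 1 < 2 :> R by lra.
have Dsub x y : D x -> abs (y - x0) <= abs (x - x0) -> D y.
  move=> Dx yx; case: Ddisc => [//|[r [_ [h|h]]]]; apply/h.
    by apply: le_lt_trans yx _; exact/h.
  by apply: le_trans yx _; exact/h.
(* The estimates use nonzero radii realised by points of [D], also when [z = x0]. *)
have Dradius z : D z -> exists x1, [/\ D x1, x1 != x0 & abs (z - x0) <= abs (x1 - x0)].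
  move=> Dz; have [zx0|] := eqVneq z x0; last by exists z.
  have [h h0 Dh] : exists2 h, h != 0 & D (x0 + h).
    case: Ddisc => [DT|[r [r0 hr]]].
      by have [h h0 _] := abs_small_exists habs (@ltr01 R); exists h.
    have [h h0 hle] := abs_small_exists habs r0; exists h => //.
    by case: hr => hr; apply/hr; rewrite addrAC subrr add0r ?ltW.
  exists (x0 + h); split=> //; first by rewrite -subr_eq0 addrAC subrr add0r.
  by rewrite zx0 subrr (abs0 habs) (abs_ge0 habs).
have gf x : D x -> g (f x) = lam * g x by case/Df => _ [].
have nonexp x : D x -> abs (f x - x0) <= abs (x - x0).
  move=> Dx; have [xE|xx0] := eqVneq x x0.
    by rewrite xE /f (ps_eval_center habs) fa0.
  have [cf _] := Df x Dx; have cg := Dg x Dx.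
  (* On this small disc [f] is visibly nonexpanding about [x0], which yields the formal identity;
     [conj_coef_bound] then carries the bound to the full radius. *)
  have [k hk] := small_radius habs two xx0 cf (etrans (f_equal abs fa1) lam1).
  have [C C0 hC] := ps_conv_bounded habs cg.
  have r0 : 0 < abs (x - x0) by rewrite (abs_gt0 habs) subr_eq0.
  have rho0 : 0 < abs (x - x0) / 2 ^+ k by rewrite divr_gt0 // exprn_gt0 //; lra.
  have rhor : abs (x - x0) / 2 ^+ k <= abs (x - x0).
    rewrite ler_pdivrMr ?exprn_gt0 //.
    by rewrite -[leLHS]mulr1 ler_pM2l // exprn_ege1 //; lra.
  have fle : forall i, (0 < i)%N -> abs (fa i) * abs (x - x0) ^+ i <= abs (x - x0).
    apply: (conj_coef_bound habs xx0 cf cg _ ga0 ga1); first by rewrite fa1.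
    move=> N i iN; rewrite (@formal_conj _ _ _ habs fa ga lam x0 _ C N fa0 lam1 rho0 (ltW C0) hk) //.
    - by rewrite (absM habs) lam1 mul1r.
    - move=> j; apply: le_trans (hC j); apply: terms_le => //; [exact: abs_ge0|exact: ltW].
    - move=> y yx; have Dy : D y by apply: (Dsub x) => //; exact: le_trans yx rhor.
      by have [? []] := Df y Dy; have := Dg y Dy.
  have -> : f x - x0 = f x - (trunc fa 1).[x - x0].
    by rewrite horner_poly big_ord1 expr0 mulr1 fa0.
  by apply: (ps_tail habs) => //; exact: abs_ge0.
have cont z e : D z -> 0 < e -> exists2 del, 0 < del &
    forall x, abs (x - z) < del -> D x /\ abs (g x - g z) < e.
  move=> Dz e0; have [x1 [Dx1 x1x0 zx1]] := Dradius z Dz.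
  have r0 : 0 < abs (x1 - x0) by rewrite (abs_gt0 habs) subr_eq0.
  have [C C0 hC] := ps_conv_bounded habs (Dg x1 Dx1).
  have Cr0 : 0 < C / abs (x1 - x0) by rewrite divr_gt0.
  exists (Num.min (abs (x1 - x0)) (e / (C / abs (x1 - x0)))).
    by rewrite lt_min r0 divr_gt0.
  move=> x; rewrite lt_min ltr_pdivlMr // => /andP[xz xe].
  have xr : abs (x - x0) <= abs (x1 - x0).
    by apply: (@abs_triangle_le _ _ _ habs z) => //; exact: ltW.
  have Dx := Dsub _ _ Dx1 xr; split=> //.
  apply: le_lt_trans (ps_lip habs (Dg x Dx) (Dg z Dz) r0 (ltW C0) xr zx1 (fun i _ => hC i)) _.
  by rewrite mulrC.
have inv y z e : D y -> D z -> 0 < e -> exists2 del, 0 < del &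
    forall x, abs (x - x0) <= abs (y - x0) -> abs (g x - g z) < del -> abs (x - z) < e.
  move=> Dy Dz e0.
  have [x1 [Dx1 x1x0 yx1 zx1]] : exists x1,
      [/\ D x1, x1 != x0, abs (y - x0) <= abs (x1 - x0) & abs (z - x0) <= abs (x1 - x0)].
    have [x1 [Dx1 x1x0 yx1]] := Dradius y Dy; have [x2 [Dx2 x2x0 zx2]] := Dradius z Dz.
    have [le12|/ltW le21] := leP (abs (x1 - x0)) (abs (x2 - x0)).
      by exists x2; split=> //; exact: le_trans le12.
    by exists x1; split=> //; exact: le_trans le21.
  have ga1n0 : ga 1%N != 0 by rewrite -(abs_eq0 habs) ga1 oner_eq0.
  have [||del del0 hdel] := ps_inverse_continuous habs hcomp x1x0 ga0 ga1n0 _ _ zx1 e0.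
  - by move=> x /(Dsub _ _ Dx1) /Dg.
  - by move=> u v /(Dsub _ _ Dx1) Du /(Dsub _ _ Dx1) Dv; exact: Dinj.
  - by exists del => // x xy; apply: hdel; exact: le_trans yx1.
have Xiter y n : X y -> X (iter n f y) by move=> Xy; elim: n => //= n; exact: Xf.
have giter y n : X y -> g (iter n f y) = lam ^+ n * g y.
  move=> Xy; elim: n => [|n IHn]; first by rewrite mul1r.
  by rewrite iterS gf ?IHn ?exprS ?mulrA //; exact/XD/Xiter.
have Titer w n : iter n (fun w => lam * w) w = lam ^+ n * w.
  by elim: n => [|n IHn]; rewrite ?mul1r // iterS IHn exprS mulrA.
have iter_le y n : X y -> abs (iter n f y - x0) <= abs (y - x0).
  move=> Xy; elim: n => //= n; apply: le_trans; exact/nonexp/XD/Xiter.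
(* Continuity of [g] gives one direction. For the other, [iter_le] keeps the orbit in the closed
   disc through [y], where [inv] applies. *)
have dense_iff y : X y ->
    (dense_in abs (Defs.orbit f y) X <-> dense_in abs (Defs.orbit (fun w => lam * w) (g y)) (img g X)).
  move=> Xy; split=> dens.
    move=> _ [z [Xz <-]] e e0; have [del del0 hdel] := cont z e (XD z Xz) e0.
    have [_ [[n <-] nz]] := dens z Xz del del0; have [_ gz] := hdel _ nz.
    by exists (g (iter n f y)); split=> //; exists n; rewrite Titer giter.
  move=> z Xz e e0; have [del del0 hdel] := inv y z e (XD y Xy) (XD z Xz) e0.
  have [_ [[n <-] nz]] := dens (g z) (ex_intro _ z (conj Xz erefl)) del del0.
  exists (iter n f y); split; first by exists n.
  by apply: hdel; [exact: iter_le|rewrite giter // -Titer].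
split.
  split=> [[y [Xy /(dense_iff y Xy) dens]]|[_ [[y [Xy <-]] /(dense_iff y Xy) dens]]].
    by exists (g y); split=> //; exists y.
  by exists y.
move=> Xcomp [y0 [Xy0 /(dense_iff y0 Xy0) dens0]].
have lamX n w : abs (lam ^+ n * w) = abs w.
  by rewrite (absM habs) (absX habs) lam1 expr1n mul1r.
have recur e : 0 < e -> exists2 q, (0 < q)%N & abs (lam ^+ q * g y0 - g y0) < e.
  (* Preimages of [e]-balls cover [X]; among [n.+1] orbit points two share one of [n] sets, and the
     isometry cancels the common power of [lam]. *)
  move=> e0; pose O (x y : K) := D y /\ abs (g y - g x) < e.
  have [||n [s hs]] := Xcomp K O.
  - move=> x y [Dy yx]; have [del del0 hdel] := cont y e Dy e0.
    exists del; split=> // z /hdel[Dz zy]; split=> //.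
    exact: (abs_triangle_lt habs) zy yx.
  - by move=> x Xx; exists x; split; [exact: XD|rewrite subrr (abs0 habs)].
  have [c hc] : exists c : 'I_n.+1 -> 'I_n, forall j : 'I_n.+1, O (s (c j)) (iter j f y0).
    by apply: (fin_all_exists (P := fun (j : 'I_n.+1) k => O (s k) (iter j f y0))) => j; exact/hs/Xiter.
  have /injectivePn[i [j ij cij]] : ~~ injectiveb c.
    by apply/negP => /injectiveP /leq_card; rewrite !card_ord ltnn.
  wlog ltij : i j ij cij / (i < j)%N.
    move=> wl; have [| |/val_inj eij] := ltngtP i j; [exact: wl| |by rewrite eij eqxx in ij].
    by apply: wl; rewrite 1?eq_sym.
  exists (j - i)%N; first by rewrite subn_gt0.
  have [_ hi] := hc i; have [_ hj] := hc j; rewrite cij in hi.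
  have : abs (lam ^+ j * g y0 - lam ^+ i * g y0) < e.
    rewrite -!giter //; apply: (abs_triangle_lt habs) hj _.
    by rewrite (absB habs).
  by rewrite -{1}(subnKC (ltnW ltij)) exprD -mulrA -mulrBr lamX.
have min : minimal_on abs f X.
  move=> y Xy; apply/(dense_iff y Xy) => _ [z [Xz <-]] e e0.
  have [_ [[a <-] ay]] := dens0 (g y) (ex_intro _ y (conj Xy erefl)) e e0.
  have [_ [[b <-] bz]] := dens0 (g z) (ex_intro _ z (conj Xz erefl)) e e0.
  have [q q0 hq] := recur e e0; rewrite !Titer in ay bz.
  have hqa : abs (lam ^+ (q * a) * g y0 - g y0) < e.
    elim: (a) => [|k IHk]; first by rewrite muln0 mul1r subrr (abs0 habs).
    apply: (@abs_triangle_lt _ _ _ habs (lam ^+ (q * k) * g y0)) => //.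
    by rewrite mulnS addnC exprD -mulrA -mulrBr lamX.
  (* Chosen so that [n + a = b + q * a]: [n] steps from near [lam ^+ a * g y0] lead near [lam ^+ b]
     times a recurrent return to [g y0], hence near [g z]. *)
  set n := (b + (q.-1 * a))%N.
  exists (lam ^+ n * g y); split; first by exists n; rewrite Titer.
  apply: (@abs_triangle_lt _ _ _ habs (lam ^+ n * (lam ^+ a * g y0))).
    by rewrite -mulrBr lamX (absB habs).
  apply: (@abs_triangle_lt _ _ _ habs (lam ^+ b * g y0)) => //.
  have -> : lam ^+ n * (lam ^+ a * g y0) = lam ^+ b * (lam ^+ (q * a) * g y0).
    by rewrite !mulrA -!exprD /n -addnA -mulSnr prednK.
  by rewrite -mulrBr lamX.
have surj y : X y -> exists x, X x /\ f x = y.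
  move=> Xy; apply: NNPP => nox.
  (* By injectivity of [g], a missed [y] keeps [lam * g x] away from [g y]; compactness makes the
     gap uniform. Openness holds because a smaller perturbation leaves an ultrametric distance
     unchanged. *)
  pose O (k : nat) (x : K) := D x /\ (2 ^+ k)^-1 < abs (lam * g x - g y).
  have pow0 k : 0 < 2 ^+ k :> R by rewrite exprn_gt0 //; lra.
  have [||n [s hs]] := Xcomp nat O.
  - move=> k x [Dx kx]; have inv0 : 0 < (2 ^+ k)^-1 :> R by rewrite invr_gt0.
    have [del del0 hdel] := cont x _ Dx (lt_trans inv0 kx).
    exists del; split=> // x' /hdel[Dx' xx']; split=> //.
    have -> : lam * g x' - g y = (lam * g x - g y) + lam * (g x' - g x) by ring.
    by rewrite (absD_dom habs) // (absM habs) lam1 mul1r.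
  - move=> x Xx.
    have pos : 0 < abs (lam * g x - g y).
      rewrite (abs_gt0 habs) subr_eq0 -gf; last exact: XD.
      by apply/eqP => gE; apply: nox; exists x; split=> //; apply: Dinj gE; exact/XD/Xf || exact: XD.
    have [k hk] := expr_unbounded ((abs (lam * g x - g y))^-1 + 1) two.
    exists k; split; first exact: XD.
    by rewrite -[ltRHS]invrK ltf_pV2 ?posrE ?invr_gt0 //; lra.
  set k := \max_(i < n) s i.
  have inv0 : 0 < (2 ^+ k)^-1 :> R by rewrite invr_gt0.
  (* Starting the orbit at [f y] makes each of its points [f] of a point of [X], so density near
     [g y] violates the gap. *)
  have Xfy := Xf y Xy.
  have [_ [[m <-]]] := iffLR (dense_iff _ Xfy) (min _ Xfy) (g y) (ex_intro _ y (conj Xy erefl)) _ inv0.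
  rewrite Titer -/(f y) gf; last exact: XD.
  rewrite mulrCA -giter //; have [i [_ hi]] := hs _ (Xiter y m Xy).
  move/(lt_trans hi); rewrite ltf_pV2 ?posrE // ltr_eXn2l; last lra.
  by rewrite ltnNge leq_bigmax.
split=> //.
  by move=> y; split=> [[x [Xx <-]]|]; [exact: Xf|exact: surj].
move=> w; split.
  move=> [x [Xx <-]]; have [x' [Xx' <-]] := surj x Xx.
  by exists (g x'); split; [exists x'|rewrite gf //; exact: XD].
move=> [_ [[x [Xx <-]] <-]]; exists (f x); split; first exact: Xf.
by rewrite gf //; exact: XD.
Qed.
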